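(* For all integers $n \geq 0$ and $l$ with $0 \leq l \leq n$, one has \[\sum_{i=0}^{l} \binom{n-i}{i}\binom{l+i}{2i+1}=\sum_{i=0}^{l} \binom{n-i}{i-1}\binom{l+i}{2i}.\]
   Context: Convention for binomial coefficients: for integers $m \geq 0$ and $j$, $\binom{m}{j}$ is the usual binomial coefficient if $0 \leq j \leq m$, and $\binom{m}{j}=0$ if $j<0$ or $j>m$. (Under the hypothesis $l \leq n$, all upper entries occurring in the identity are non-negative.) *)

(* Defs.v *)
From mathcomp Require Import all_boot all_order all_algebra.
Set Implicit Arguments.
Unset Strict Implicit.
Unset Printing Implicit Defensive.

(* Binomial coefficient with an integer lower entry: zero when j < 0. For
   j >= 0 it is the library's 'C(m, j), which already vanishes when j > m. *)
Definition binz (m : nat) (j : int) : nat :=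
  match j with
  | Posz k => 'C(m, k)
  | Negz _ => 0
  end.

(* Main.v *)
Require Import Defs.
From mathcomp Require Import all_boot all_order all_algebra.
From mathcomp Require Import ring zify.

(** With D = (1 - z)(1 - x)^2 - z^2 x, the two sides have the generating
    functions x / D and z x / ((1 - x) D) (z marking n, x marking l).  Since
    D = (1 - x - z)(1 - x + z x), their difference is
    x / ((1 - x)(1 - x + z x)), that is, LHS - RHS = (-1)^n C(l, n + 1) for all
    n and l, which vanishes when l <= n.  This is established by checking that
    both members satisfy the recurrence
    Delta_l^2 (H(n + 2, .) - H(n + 1, .)) = H(n, .), which encodes D. *)

Section SecondDifference.

Import GRing.Theory.
Local Open Scope ring_scope.

Lemma bin_second_diff (m k : nat) :
  'C(m.+2, k.+2)%:Z - 2 * 'C(m.+1, k.+2)%:Z + 'C(m, k.+2)%:Z = 'C(m, k)%:Z.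
Proof. by rewrite !binS !PoszD; ring. Qed.

Section WeightedSum.

Variables c a : nat -> nat -> int.

Definition wsum (N n l : nat) : int := \sum_(i < N) c n i * a l i.

Hypothesis cS0 : forall n, c n.+2 0 = c n.+1 0.
Hypothesis cSS : forall n i, c n.+2 i.+1 = c n.+1 i.+1 + c n i.
Hypothesis a_diff : forall l i,
  a l.+2 i.+1 - 2 * a l.+1 i.+1 + a l i.+1 = a l.+1 i.

(** By [cS0] the terms at index 0 cancel; by [cSS] the others leave [c n], with the index of [a]
    shifted by one. *)
Lemma wsum_step (N n l : nat) :
  wsum N.+1 n.+2 l - wsum N.+1 n.+1 l = \sum_(i < N) c n i * a l i.+1.
Proof.
rewrite /wsum !big_ord_recl /= cS0 opprD addrACA subrr add0r -sumrB.
by apply: eq_bigr => i _; rewrite /bump /= add1n cSS; ring.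
Qed.

Lemma wsum_rec (N n l : nat) :
  wsum N.+1 n.+2 l.+2 =
    wsum N.+1 n.+1 l.+2 + 2 * (wsum N.+1 n.+2 l.+1 - wsum N.+1 n.+1 l.+1)
    - (wsum N.+1 n.+2 l - wsum N.+1 n.+1 l) + wsum N n l.+1.
Proof.
have diffE : wsum N n l.+1 =
    (wsum N.+1 n.+2 l.+2 - wsum N.+1 n.+1 l.+2)
    - 2 * (wsum N.+1 n.+2 l.+1 - wsum N.+1 n.+1 l.+1)
    + (wsum N.+1 n.+2 l - wsum N.+1 n.+1 l).
  rewrite !wsum_step mulr_sumr -sumrB -big_split /=.
  by apply: eq_bigr => i _; rewrite -a_diff; ring.
by rewrite diffE; ring.
Qed.

End WeightedSum.

Definition coefL (n i : nat) : int := 'C(n - i, i)%:Z.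

(* The value at n = 0, i = 1 must be 0 for the recurrence in n to hold, whereas
   truncated subtraction would give 'C(0 - 1, 0) = 1. *)
Definition coefR (n i : nat) : int :=
  match n, i with
  | n'.+1, j.+1 => 'C(n' - j, j)%:Z
  | _, _ => 0
  end.

Definition basisL (l i : nat) : int := 'C(l + i, 2 * i + 1)%:Z.
Definition basisR (l i : nat) : int := 'C(l + i, 2 * i)%:Z.

Lemma bin_sub_rec (n i : nat) :
  'C(n.+1 - i, i.+1) = ('C(n - i, i.+1) + 'C(n - i, i))%N.
Proof.
case: (leqP i n) => [le_in | lt_ni]; first by rewrite subSn // binS.
(* Here both upper entries truncate to 0 while [i] is positive, so all three binomials vanish. *)
have -> : (n.+1 - i = 0)%N by lia.
have -> : (n - i = 0)%N by lia.
by case: i lt_ni.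
Qed.

Lemma coefL_rec (n i : nat) : coefL n.+2 i.+1 = coefL n.+1 i.+1 + coefL n i.
Proof. by rewrite /coefL !subSS bin_sub_rec PoszD. Qed.

Lemma coefR_rec (n i : nat) : coefR n.+2 i.+1 = coefR n.+1 i.+1 + coefR n i.
Proof.
case: i => [|i]; first by case: n => [|n]; rewrite /= !bin0 addr0.
case: n => [|n] /=; first by rewrite addr0 subSS !sub0n.
by rewrite !subSS bin_sub_rec PoszD.
Qed.

Lemma basisL_diff (l i : nat) :
  basisL l.+2 i.+1 - 2 * basisL l.+1 i.+1 + basisL l i.+1 = basisL l.+1 i.
Proof.
rewrite /basisL -[RHS]bin_second_diff.
have -> : (l.+2 + i.+1 = (l.+1 + i).+2)%N by lia.
have -> : (l.+1 + i.+1 = (l.+1 + i).+1)%N by lia.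
have -> : (l + i.+1 = l.+1 + i)%N by lia.
by have -> : (2 * i.+1 + 1 = (2 * i + 1).+2)%N by lia.
Qed.

Lemma basisR_diff (l i : nat) :
  basisR l.+2 i.+1 - 2 * basisR l.+1 i.+1 + basisR l i.+1 = basisR l.+1 i.
Proof.
rewrite /basisR -[RHS]bin_second_diff.
have -> : (l.+2 + i.+1 = (l.+1 + i).+2)%N by lia.
have -> : (l.+1 + i.+1 = (l.+1 + i).+1)%N by lia.
have -> : (l + i.+1 = l.+1 + i)%N by lia.
by have -> : (2 * i.+1 = (2 * i).+2)%N by lia.
Qed.

(** The length [N] is independent of [l] because the recurrence shortens one sum; once [l < N],
    every nonzero term is included. *)
Definition defect (N n l : nat) : int :=
  wsum coefL basisL N n l - wsum coefR basisR N n l.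

Lemma defect_rec (N n l : nat) :
  defect N.+1 n.+2 l.+2 =
    defect N.+1 n.+1 l.+2 + 2 * (defect N.+1 n.+2 l.+1 - defect N.+1 n.+1 l.+1)
    - (defect N.+1 n.+2 l - defect N.+1 n.+1 l) + defect N n l.+1.
Proof.
have coefL0 m : coefL m.+2 0 = coefL m.+1 0 by rewrite /coefL !bin0.
rewrite /defect (wsum_rec _ _ coefL0 coefL_rec basisL_diff).
by rewrite (wsum_rec coefR _ (fun=> erefl) coefR_rec basisR_diff); ring.
Qed.

(** Serves both kinds of initial values: the tail vanishes through [coefL] when n <= 1 and through
    [basisL] when l <= 1. *)
Lemma wsumL_init (N n l : nat) :
  (forall i, coefL n i.+1 * basisL l i.+1 = 0) -> wsum coefL basisL N.+1 n l = l%:Z.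
Proof.
move=> tail0; rewrite /wsum big_ord_recl big1 => [|i _]; last exact: tail0.
by rewrite /coefL /basisL subn0 bin0 addn0 bin1 mul1r addr0.
Qed.

Lemma wsumR_init (N n l : nat) : (l < N)%N ->
  (forall i, coefR n.+1 i.+2 * basisR l i.+2 = 0) ->
  wsum coefR basisR N n.+1 l = 'C(l.+1, 2)%:Z.
Proof.
case: N => // N lt_lN tail0; rewrite /wsum big_ord_recl mul0r add0r.
case: N lt_lN => [|N] lt_lN.
  (* The only contributing index, 1, is out of range, but then l = 0 and 'C(1, 2) = 0. *)
  by rewrite big_ord0; case: l lt_lN tail0.
rewrite big_ord_recl big1 => [|i _]; last exact: tail0.
by rewrite /= bin0 /basisR addn1 mul1r addr0.
Qed.

Lemma wsumR0 (N l : nat) : wsum coefR basisR N 0 l = 0.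
Proof. by rewrite /wsum big1 // => i _; exact: mul0r. Qed.

Lemma defect0 (N l : nat) : (l < N)%N -> defect N 0 l = l%:Z.
Proof. by case: N => // N _; rewrite /defect wsumR0 subr0 wsumL_init. Qed.

Lemma defect1 (N l : nat) : (l < N)%N -> defect N 1 l = - 'C(l, 2)%:Z.
Proof.
move=> lt_lN; rewrite /defect wsumR_init //.
case: N lt_lN => // N _; rewrite wsumL_init => [|i].
  by rewrite binS bin1 PoszD; ring.
by rewrite /coefL subSS sub0n mul0r.
Qed.

Lemma defect_small (N n l : nat) :
  (l < N)%N -> (l <= 1)%N -> defect N n.+1 l = 0.
Proof.
move=> lt_lN le_l1; rewrite /defect wsumR_init // => [|i]; last first.
  by rewrite /basisR bin_small ?mulr0 //; lia.
case: N lt_lN => // N _; rewrite wsumL_init => [|i].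
  by case: l le_l1 => [|[|]].
by rewrite /basisL bin_small ?mulr0 //; lia.
Qed.

Lemma defectE (N n l : nat) :
  (l < N)%N -> defect N n l = (-1) ^+ n * 'C(l, n.+1)%:Z.
Proof.
(* The recurrence has order two in both variables: strong induction on [n], then on [l], each with
   base cases 0 and 1. *)
have [k] := ubnP n; elim: k => // k IHn in N n l *.
case: n => [_ lt_lN|[_ lt_lN|n lt_nk]].
- by rewrite defect0 // bin1 expr0 mul1r.
- by rewrite defect1 // expr1 mulN1r.
have [m] := ubnP l; elim: m => // m IHl in l *.
case: l => [_ lt_lN|[_ lt_lN|l lt_lm lt_lN]].
- by rewrite defect_small // mulr0.
- by rewrite defect_small // bin_small // mulr0.
case: N => // N in lt_lN IHl *.
rewrite defect_rec (IHl l.+1) ?(IHl l) ?IHn; try lia.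
(* By Pascal's rule, the closed form obeys the same recurrence. *)
by rewrite !exprS !binS !PoszD; ring.
Qed.

End SecondDifference.

(* Since i <= l <= n, the natural-number subtraction n - i never truncates;
   the lower entry i - 1 is computed in int, as it equals -1 at i = 0. *)
Theorem mainTheorem1 (n l : nat) (hln : l <= n) :
  \sum_(0 <= i < l.+1) 'C(n - i, i) * 'C(l + i, 2 * i + 1) =
  \sum_(0 <= i < l.+1) binz (n - i) (i%:Z - 1)%R * 'C(l + i, 2 * i).
Proof.
have := @defectE l.+1 n l (ltnSn l).
rewrite bin_small // GRing.mulr0 => /eqP; rewrite GRing.subr_eq0 => /eqP eqLR.
rewrite !big_mkord.
have sumZ (F : 'I_l.+1 -> nat) : Posz (\sum_i F i) = (\sum_i (F i)%:Z)%R.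
  by elim/big_rec2: _ => // i x y _ <-; rewrite PoszD.
apply/eqP; rewrite -eqz_nat !sumZ; apply/eqP.
transitivity (wsum coefL basisL l.+1 n l).
  by apply: eq_bigr => i _; rewrite PoszM.
rewrite eqLR; apply: eq_bigr => i _; rewrite PoszM; congr (_ * _)%R.
have := leq_trans (leq_ord i) hln.
(* As i <= n, the exceptional value of [coefR] at n = 0, i = 1 is never met. *)
case: n {hln eqLR} => [|n]; case: (nat_of_ord i) => [|j] //= le_jn.
by rewrite subSS subn1.
Qed.
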